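(* The no-partial-erasure theorem implies the no-splitting of quantum information. That is, suppose that for every embedded smooth submanifold $S$ of dimension strictly less than $2$ of the set $P_2$ of pure qubit states, there is no completely positive, trace-preserving linear map $\mathcal{E}:M_2(\mathbb{C})\to M_2(\mathbb{C})$, not constant on $P_2$, such that $\mathcal{E}(p)$ is a pure state belonging to $S$ for every $p\in P_2$. Then there is no splitting operation. Namely, for any family $(|\phi\rangle)_{\phi\in[0,2\pi)}$ of unit vectors in $\mathbb{C}^2$ (depending only on $\phi$), there is no completely positive, trace-preserving linear map $\mathcal{F}:M_2(\mathbb{C})\to M_2(\mathbb{C})\otimes M_2(\mathbb{C})$ such that $$\mathcal{F}(|\theta,\phi\rangle\langle\theta,\phi|)=|\theta\rangle\langle\theta|\otimes|\phi\rangle\langle\phi|\qquad\text{for all }\theta\in[0,\pi],\ \phi\in[0,2\pi).$$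
   Context: For $\theta\in[0,\pi]$ and $\phi\in[0,2\pi)$, $|\theta,\phi\rangle=\cos\tfrac{\theta}{2}|0\rangle+e^{i\phi}\sin\tfrac{\theta}{2}|1\rangle\in\mathbb{C}^2$ is a general pure qubit state, and $|\theta\rangle=\cos\tfrac{\theta}{2}|0\rangle+\sin\tfrac{\theta}{2}|1\rangle$ is the state carrying only the polar-angle information (azimuthal angle fixed to $0$). The set $P_2$ consists of the rank-one orthogonal projections on $\mathbb{C}^2$ and is identified with the 2-sphere $\mathbb{CP}^1$. Splitting a qubit means transforming $|\theta,\phi\rangle$ into a product state $|\theta\rangle|\phi\rangle$ in which the first qubit represents the $\theta$ information and the second represents the $\phi$ information. Physical operations are completely positive, trace-preserving linear maps. *)

(* Defs.v *)
From HB Require Import structures.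
From mathcomp Require Import all_boot all_order all_algebra.
From mathcomp Require Import all_classical all_reals all_analysis.
From mathcomp Require Import complex mxtens.

Set Implicit Arguments.
Unset Strict Implicit.
Unset Printing Implicit Defensive.

Import Order.TTheory GRing.Theory Num.Theory.
Import numFieldNormedType.Exports.

Local Open Scope classical_set_scope.
Local Open Scope ring_scope.
Local Open Scope sesquilinear_scope.

(* The usual topology of the complex numbers, given by the modulus. *)
HB.instance Definition _ (R : rcfType) := Uniform.copy R[i] R[i]^o.

Section Quantum.
Variable R : realType.
Local Notation C := R[i].

(* Rank-one orthogonal projections; P_2 is [pure 2]. *)
Definition pure (n : nat) : set 'M[C]_n :=
  [set p | [/\ p ^t* = p, p *m p = p & \rank p = 1%N]].

Definition unit_vector (n : nat) (v : 'cV[C]_n) : Prop := v ^t* *m v = 1%:M.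

(* |v><v| *)
Definition ketbra (n : nat) (v : 'cV[C]_n) : 'M[C]_n := v *m v ^t*.

(* In [C], [0 <= z] includes the assertion that [z] is real. *)
Definition psd (n : nat) (A : 'M[C]_n) : Prop :=
  forall v : 'cV[C]_n, 0 <= (v ^t* *m A *m v) 0 0.

(* [id_k (x) E] on M_k (x) M_m, a matrix over M_k (x) M_m being split into the
   k * k blocks of size m indexed by the matrix units of M_k. *)
Definition block (k m : nat) (X : 'M[C]_(k * m)) (i j : 'I_k) : 'M[C]_m :=
  \matrix_(a, b) X (mxtens_index (i, a)) (mxtens_index (j, b)).

Definition ampliation (k m n : nat) (E : 'M[C]_m -> 'M[C]_n)
    (X : 'M[C]_(k * m)) : 'M[C]_(k * n) :=
  \sum_(i < k) \sum_(j < k) (delta_mx i j : 'M[C]_k) *t E (block X i j).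

Definition completely_positive (m n : nat) (E : 'M[C]_m -> 'M[C]_n) : Prop :=
  forall (k : nat) (X : 'M[C]_(k * m)), psd X -> psd (ampliation E X).

Definition trace_preserving (m n : nat) (E : 'M[C]_m -> 'M[C]_n) : Prop :=
  forall X : 'M[C]_m, \tr (E X) = \tr X.

Definition cptp (m n : nat) (E : {linear 'M[C]_m -> 'M[C]_n}) : Prop :=
  completely_positive E /\ trace_preserving E.

Definition constant_on (T U : Type) (A : set T) (f : T -> U) : Prop :=
  forall x y, A x -> A y -> f x = f y.

(* The states |theta,phi> and |theta>, in the basis |0>, |1>. *)
Definition qubit (theta phi : R) : 'cV[C]_2 :=
  \col_(k < 2) if k == 0 then Complex (cos (theta / 2)) 0
               else Complex (cos phi) (sin phi) * Complex (sin (theta / 2)) 0.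

Definition polar (theta : R) : 'cV[C]_2 :=
  \col_(k < 2) if k == 0 then Complex (cos (theta / 2)) 0
               else Complex (sin (theta / 2)) 0.

(* [f] is C^k, resp. smooth, on [A], which is meant to be open: all iterated
   partial derivatives (of order at most [k]) exist and are continuous on A. *)
Fixpoint Ck_on (m n k : nat) (A : set 'rV[R]_m) (f : 'rV[R]_m -> 'rV[R]_n)
    : Prop :=
  (forall x, A x -> {for x, continuous f}) /\
  if k is k'.+1 then
    forall i : 'I_m, (forall x, A x -> derivable f x (delta_mx 0 i)) /\
                     Ck_on k' A (fun x => 'D_(delta_mx 0 i) f x)
  else True.

Definition smooth_on (m n : nat) (A : set 'rV[R]_m) (f : 'rV[R]_m -> 'rV[R]_n)
    : Prop := forall k, Ck_on k A f.

(* The two standard affine charts of CP^1, with values in R^2 = C.  A line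
   spanned by [v] is represented by the projection p = |v><v| / <v|v>, so
   p_ji / p_ii = v_j / v_i: chart [i] is defined where p_ii <> 0. *)
Definition affine_dom (i : 'I_2) : set 'M[C]_2 := [set p | p i i != 0].

Definition affine_chart (i : 'I_2) (p : 'M[C]_2) : 'rV[R]_2 :=
  let z := p (rev_ord i) i / p i i in
  \row_(k < 2) if k == 0 then complex.Re z else complex.Im z.

(* The inverse chart: z |-> the projection onto the line spanned by the vector
   whose i-th coordinate is 1 and whose other coordinate is z. *)
Definition affine_param (i : 'I_2) (x : 'rV[R]_2) : 'M[C]_2 :=
  let v : 'cV[C]_2 := \col_(k < 2) if k == i then 1 else Complex (x 0 0) (x 0 1) in
  ((v ^t* *m v) 0 0)^-1 *: ketbra v.

(* (U, f) is a chart of the maximal smooth atlas of P_2, and [g] is the inverse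
   of [f] on f(U): [f] is a homeomorphism from the open subset [U] of P_2 onto
   an open subset of R^2, and is smoothly compatible with both affine charts. *)
Definition smooth_chart (U : set 'M[C]_2)
    (f : 'M[C]_2 -> 'rV[R]_2) (g : 'rV[R]_2 -> 'M[C]_2) : Prop :=
  [/\ exists2 O : set 'M[C]_2, open O & U = @pure 2 `&` O,
      open (f @` U),
      forall p, U p -> g (f p) = p,
      {within U, continuous f} /\ {within f @` U, continuous g} &
      forall i : 'I_2,
        smooth_on (affine_param i @^-1` U) (f \o affine_param i) /\
        smooth_on (f @` (U `&` affine_dom i)) (affine_chart i \o g)].

(* [S] is an embedded d-dimensional smooth submanifold of P_2: around each of
   its points there is a slice chart of P_2, in which [S] is given by the
   vanishing of the coordinates of index at least [d]. *)
Definition embedded_submanifold (d : nat) (S : set 'M[C]_2) : Prop :=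
  (d <= 2)%N /\ S `<=` @pure 2 /\
  forall p, S p -> exists U f g,
    [/\ smooth_chart U f g, U p &
        f @` (U `&` S) =
        f @` U `&` [set x | forall k : 'I_2, (d <= k)%N -> x 0 k = 0]].

End Quantum.

(* Main.v *)
(* At the pole theta = 0 the state does not depend on phi, so the outputs force
   the projection onto |phi> to be independent of phi. Linearity applied to
   |+><+| + |-><-| = |0><0| + |1><1| then equates an output with nonzero
   off-diagonal block to one whose off-diagonal block vanishes. *)
Require Import Defs.
From mathcomp Require Import all_boot all_order all_algebra.
From mathcomp Require Import all_classical all_reals all_analysis.
From mathcomp Require Import complex mxtens.
From mathcomp Require Import lra.

Import Order.TTheory GRing.Theory Num.Theory.
Local Open Scope classical_set_scope.
Local Open Scope ring_scope.

Lemma ketbraE (R : realType) (n : nat) (v : 'cV[R[i]]_n) (a b : 'I_n) :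
  ketbra v a b = v a 0 * (v b 0)^*.
Proof. by rewrite /ketbra !mxE big_ord1 !mxE. Qed.

(** For a unit vector, [v] equals its image under [ketbra v], so a zero [ketbra v] would force
    [v = 0]. *)
Lemma unit_vector_ketbra_neq0 (R : realType) (n : nat) (v : 'cV[R[i]]_n) :
  unit_vector v -> ketbra v != 0.
Proof.
move=> v1; apply/eqP => v0.
have vE : v = 0 by rewrite -[v]mulmx1 -v1 mulmxA [v *m _]v0 mul0mx.
by move/matrixP/(_ 0 0)/eqP: v1; rewrite vE mulmx0 !mxE eq_sym oner_eq0.
Qed.

Lemma qubit0 (R : realType) (phi : R) : qubit 0 phi = delta_mx 0 0.
Proof.
apply/matrixP => a b; rewrite !mxE (ord1 b) eqxx andbT mul0r cos0 sin0.
by case: (a == 0); rewrite ?mulr0.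
Qed.

(** Each side sums the projections onto an orthonormal basis, hence is the identity matrix. *)
Lemma ketbra_qubit_equator (R : realType) :
  ketbra (qubit (pi / 2) 0) + ketbra (qubit (pi / 2) pi) =
  ketbra (qubit 0 0) + ketbra (qubit pi 0) :> 'M[R[i]]_2.
Proof.
(* At a quarter of pi, the squares of cosine and sine differ by [cos (pi / 2) = 0] and sum to 1. *)
have c2 : cos (pi / 2 / 2) * cos (pi / 2 / 2) = 2^-1 :> R.
  have := cos2Dsin2 (pi / 2 / 2 : R); have := cosD (pi / 2 / 2) (pi / 2 / 2 : R).
  by rewrite -splitr cos_pihalf; nra.
have s2 : sin (pi / 2 / 2) * sin (pi / 2 / 2) = 2^-1 :> R.
  by have := cos2Dsin2 (pi / 2 / 2 : R); nra.
apply/matrixP => a b; rewrite [LHS]mxE [RHS]mxE !ketbraE !mxE.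
rewrite !mul0r !cos0 !sin0 !cospi !sinpi cos_pihalf sin_pihalf.
case: (a == 0); case: (b == 0); apply/eqP; rewrite eq_complex /=;
  by apply/andP; split; apply/eqP; lra.
Qed.

(** By the double-angle formula, this coherence vanishes at both poles and is one half on the
    equator. *)
Lemma ketbra_polar01 (R : realType) (theta : R) :
  ketbra (polar theta) 0 1 = Complex (sin theta / 2) 0.
Proof.
have := sinD (theta / 2) (theta / 2); rewrite -splitr => sE.
rewrite ketbraE !mxE /=; apply/eqP; rewrite eq_complex /=.
by apply/andP; split; apply/eqP; lra.
Qed.

Theorem corollary5 (R : realType) :
  (forall (d : nat) (S : set 'M[R[i]]_2),
     (d < 2)%N -> embedded_submanifold d S ->
     ~ exists E : {linear 'M[R[i]]_2 -> 'M[R[i]]_2},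
         [/\ cptp E,
             ~ constant_on (@pure R 2) E &
             forall p, pure p -> pure (E p) /\ S (E p)]) ->
  forall ket : R -> 'cV[R[i]]_2,
    (forall phi, 0 <= phi < 2 * pi -> unit_vector (ket phi)) ->
    ~ exists F : {linear 'M[R[i]]_2 -> 'M[R[i]]_(2 * 2)},
        cptp F /\
        forall theta phi : R, 0 <= theta <= pi -> 0 <= phi < 2 * pi ->
          F (ketbra (qubit theta phi)) =
          ketbra (polar theta) *t ketbra (ket phi).
Proof.
move=> _ ket ket1 [F [_ FE]].
have pi0 := pi_gt0 R.
have h0 : 0 <= (0 : R) < 2 * pi by lra.
have hpi : 0 <= (pi : R) < 2 * pi by lra.
have t0 : 0 <= (0 : R) <= pi by lra.
have tpi : 0 <= (pi : R) <= pi by lra.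
have th : 0 <= (pi / 2 : R) <= pi by lra.
have ketpi : ketbra (ket pi) = ketbra (ket 0).
  apply/matrixP => a b.
  (* The same input, read with azimuth [pi] and with azimuth 0, gives two expressions for one
     output. *)
  have := FE _ _ t0 hpi; rewrite qubit0 -(qubit0 _ 0) (FE _ _ t0 h0).
  (* In this block the first factor contributes [cos 0 * cos 0 = 1], which leaves the second factor
     alone. *)
  move/matrixP/(_ (mxtens_index (0, a)) (mxtens_index (0, b))).
  rewrite !tensmxE [ketbra (polar 0) 0 0]ketbraE !mxE /= mul0r cos0.
  by rewrite conjC1 mulr1 !mul1r.
have /negP := unit_vector_ketbra_neq0 _ _ _ (ket1 _ h0); apply.
apply/eqP/matrixP => a b.
have := congr1 F (ketbra_qubit_equator R).
(* By [ketpi], all four outputs now share the second factor [ketbra (ket 0)], which can be factored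
   out. *)
rewrite !linearD !FE // ketpi.
move/matrixP/(_ (mxtens_index (0, a)) (mxtens_index (1, b))).
rewrite [in X in X = _]mxE [in X in _ = X]mxE !tensmxE -!mulrDl !ketbra_polar01 sin0 sinpi sin_pihalf.
(* The equator coefficients add up to 1 and the pole ones to 0, so the [a], [b] entry of
   [ketbra (ket 0)] is 0. *)
have -> : Complex (1 / 2 : R) 0 + Complex (1 / 2) 0 = 1.
  by apply/eqP; rewrite eq_complex /=; apply/andP; split; apply/eqP; lra.
by rewrite mul0r addr0 mul0r mul1r => ->; rewrite mxE.
Qed.
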